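(* Let $d\ge2$ and fix $0<a<b$. There exists an even integer $h_0>0$, depending only on $a,b$ (and on the dimension $d$), such that for every integer $n\ge1$, every integer $H\ge\frac12h_0n$ and every configuration of capacities $t_e\in\{a,b\}$ assigned to the edges of $[0,n]^{d-1}\times[0,H]$, the following holds: for every minimal cutset $E$ of the cylinder $[0,n]^{d-1}\times[0,H]$ there exists $u\ge0$ such that $$E\subset[0,n]^{d-1}\times\left[u,u+\tfrac12h_0n\right].$$
   Context: Edges are nearest-neighbour edges of $\mathbb Z^d$, regarded also as unit segments of $\mathbb R^d$ (so the inclusion of $E$ in a cylinder means that all its edges are contained in that cylinder). The bottom of the cylinder $[0,n]^{d-1}\times[0,H]$ is $B=([0,n]^{d-1}\times\{0\})\cap\mathbb Z^d$ and its top is $T=([0,n]^{d-1}\times\{H\})\cap\mathbb Z^d$. A set of edges $E$ is a cutset if every nearest-neighbour path from $B$ to $T$ staying in the cylinder uses at least one edge of $E$. Its capacity is $\sum_{e\in E}t_e$. A minimal cutset is a cutset whose capacity is minimal among all cutsets of the cylinder, i.e. equal to the maximal flow $\Phi([0,n]^{d-1}\times\{0\},H)$. *)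

(* Defs.v *)
From mathcomp Require Import all_boot all_order all_algebra.
From mathcomp Require Import finmap.
From mathcomp Require Import boolp classical_sets reals.

Set Implicit Arguments.
Unset Strict Implicit.
Unset Printing Implicit Defensive.

Import Order.TTheory GRing.Theory Num.Theory.

Local Open Scope classical_set_scope.
Local Open Scope ring_scope.

(* An edge is the set {x, y} of its two endpoints in Z^d; that these are
   nearest neighbours is required in cylinder_edge. *)
Notation edge d := {fset 'rV[int]_d}.

Definition neighbor (d : nat) (x y : 'rV[int]_d) : bool :=
  \sum_i `|x 0 i - y 0 i| == 1.

Definition embed (R : realType) (d : nat) (x : 'rV[int]_d) : 'rV[R]_d :=
  map_mx intr x.

Definition segment (R : realType) (d : nat) (e : edge d) : set 'rV[R]_d :=
  [set z | exists x y : 'rV[int]_d, e = [fset x; y]%fset /\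
     exists s : R, 0 <= s <= 1 /\ z = (1 - s) *: embed R x + s *: embed R y].
Arguments segment R {d} e _.

(* [0,n]^(d-1) x [u,v]; the last coordinate, of index d.-1, is the height. *)
Definition cylinder (R : realType) (d n : nat) (u v : R) : set 'rV[R]_d :=
  [set z | forall i : 'I_d,
     if (i.+1 < d)%N then 0 <= z 0 i <= n%:R else u <= z 0 i <= v].
Arguments cylinder {R} d n u v _.

Definition cylinder_edge (R : realType) (d n H : nat) (e : edge d) : Prop :=
  (exists x y : 'rV[int]_d, neighbor x y /\ e = [fset x; y]%fset) /\
  segment R e `<=` cylinder d n 0 H%:R.
Arguments cylinder_edge R {d} n H e.

Definition cylinder_bottom (R : realType) (d n : nat) : set 'rV[int]_d :=
  [set x | cylinder d n 0 0 (embed R x)].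
Arguments cylinder_bottom R {d} n _.

Definition cylinder_top (R : realType) (d n H : nat) : set 'rV[int]_d :=
  [set x | cylinder d n H%:R H%:R (embed R x)].
Arguments cylinder_top R {d} n H _.

(* The edges used by the vertex path x :: p. *)
Definition path_edges (d : nat) (x : 'rV[int]_d) (p : seq 'rV[int]_d) :
    seq (edge d) :=
  pairmap (fun y z => [fset y; z]%fset) x p.

Definition cutset (R : realType) (d n H : nat) (E : {fset edge d}) : Prop :=
  (forall e, e \in E -> cylinder_edge R n H e) /\
  (forall (x : 'rV[int]_d) (p : seq 'rV[int]_d),
     cylinder_bottom R n x -> cylinder_top R n H (last x p) ->
     path (@neighbor d) x p ->
     (forall e, e \in path_edges x p -> segment R e `<=` cylinder d n 0 H%:R) ->
     exists e, e \in path_edges x p /\ e \in E).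
Arguments cutset R {d} n H E.

Definition capacity (R : realType) (d : nat) (t : edge d -> R)
    (E : {fset edge d}) : R :=
  \sum_(e <- E) t e.

Definition minimal_cutset (R : realType) (d n H : nat) (t : edge d -> R)
    (E : {fset edge d}) : Prop :=
  cutset R n H E /\
  (forall F : {fset edge d}, cutset R n H F -> capacity t E <= capacity t F).

(* Main.v *)
Require Import Defs.
From mathcomp Require Import all_boot all_order all_algebra.
From mathcomp Require Import finmap reals zify.

Set Implicit Arguments.
Unset Strict Implicit.
Unset Printing Implicit Defensive.

Import Order.TTheory GRing.Theory Num.Theory.

(**
Write D = d - 1 and N = (n + 1)^D. A minimal cutset E is the edge boundary of the set S of
vertices reachable from the bottom without using E. Let A_k be the slice of S at height k.
Replacing S by its part of height at most k only adds the vertical edges above A_k, so by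
minimality E has at most (b / a) |A_k| edges starting from vertices of S above height k. Every
column of A_k leaves S above k, so |A_j| <= (b / a) |A_k| for j >= k: once a slice is small it
stays small. The isoperimetric inequality |dA| >= c |A|^((D - 1) / D) then makes the number F(k)
of edges above k satisfy F(k) - F(k + 1) >= c F(k + 1)^((D - 1) / D), so that F vanishes after
O(n) levels. Turning the cylinder upside down gives the same statement for small complements of
slices. In the remaining levels both A_k and its complement have at least a constant proportion
of the N points, hence a boundary of order N / n by Cheeger's inequality in the box; as E has at
most (b / a) N edges there are O(n) such levels.
*)

(** * Isoperimetry in the box *)

Definition upd (D n : nat) (x : {ffun 'I_D -> 'I_n.+1}) (i : 'I_D) (t : 'I_n.+1) :
    {ffun 'I_D -> 'I_n.+1} :=
  [ffun j => if j == i then t else x j].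

(** Coordinate [i] is set to [ord0] rather than dropped, so projections stay in the same box. *)
Definition proj (D n : nat) (i : 'I_D) (A : {set {ffun 'I_D -> 'I_n.+1}}) :=
  [set upd x i ord0 | x in A].

(** Boundary edges are ordered pairs, inner endpoint first, so each edge is counted once. *)
Definition line_boundary (D n : nat) (i : 'I_D) (A : {set {ffun 'I_D -> 'I_n.+1}}) :=
  [set xy : {ffun 'I_D -> 'I_n.+1} * {ffun 'I_D -> 'I_n.+1} |
    [&& xy.1 \in A, xy.2 \notin A, xy.2 == upd xy.1 i (xy.2 i) &
        (xy.2 i == (xy.1 i).+1 :> nat) || (xy.1 i == (xy.2 i).+1 :> nat)]].

Definition boundary (D n : nat) (A : {set {ffun 'I_D -> 'I_n.+1}}) :=
  [set xy | [exists i, xy \in line_boundary i A]].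

Section Box.
Variables D n : nat.
Local Notation V := {ffun 'I_D -> 'I_n.+1}.
Implicit Types (x y z : V) (i j : 'I_D) (A : {set V}).

Lemma upd_id x i : upd x i (x i) = x.
Proof. by apply/ffunP => j; rewrite ffunE; case: eqP => [->|]. Qed.

Lemma upd_at x i t : upd x i t i = t.
Proof. by rewrite ffunE eqxx. Qed.

Lemma upd_upd x i s t : upd (upd x i s) i t = upd x i t.
Proof. by apply/ffunP => j; rewrite !ffunE; case: eqP. Qed.

Lemma upd_neq x i t j : j != i -> upd x i t j = x j.
Proof. by rewrite ffunE => /negbTE ->. Qed.

Lemma eq_upd x y i s t : upd x i s = upd y i s -> upd x i t = upd y i t.
Proof. by move=> e; rewrite -(upd_upd x i s) e upd_upd. Qed.

Definition fiber i x A := [set y in A | upd y i ord0 == upd x i ord0].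

Lemma card_box : #|{: V}| = n.+1 ^ D.
Proof. by rewrite card_ffun !card_ord. Qed.

(** Induction on the number [k] of free coordinates: a fibre in direction [k] has at least [s]
    points, and the sections with [k] free coordinates through them are disjoint. *)
Lemma leq_card_thick_fibers s A : A != set0 ->
  (forall i x, x \in A -> s <= #|fiber i x A|) -> s ^ D <= #|A|.
Proof.
move=> /set0Pn [x0 x0A] thick.
suff H k x : k <= D -> x \in A ->
    s ^ k <= #|[set y in A | [forall j : 'I_D, (k <= j) ==> (y j == x j)]]|.
  apply: leq_trans (H D x0 (leqnn _) x0A) _.
  by apply/subset_leq_card/fintype.subsetP => y; rewrite inE => /andP[].
elim: k x => [|k IH] x kD xA.
  rewrite expn0 card_gt0; apply/set0Pn; exists x; rewrite inE xA /=.
  by apply/forallP => j; rewrite eqxx.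
pose i := Ordinal kD.
rewrite -sum1_card (partition_big (fun z : V => z i) xpredT) //=.
apply: leq_trans (_ : \sum_(t in [set y i | y : V in fiber i x A]) s ^ k <= _).
  rewrite sum_nat_const expnSr mulnC leq_mul2r card_in_imset ?thick ?orbT //.
  move=> y z; rewrite !inE => /andP[_ /eqP ey] /andP[_ /eqP ez] e.
  by rewrite -(upd_id y i) -(upd_id z i) e; apply: (@eq_upd _ _ _ ord0); rewrite ey ez.
rewrite [leqRHS](bigID (mem [set y i | y : V in fiber i x A])) /=.
apply: leq_trans (leq_addr _ _); apply: leq_sum => t /imsetP [y].
rewrite inE => /andP[yA /eqP ey] ->.
apply: leq_trans (IH y (ltnW kD) yA) _; rewrite sum1_card.
apply/subset_leq_card/fintype.subsetP => z; rewrite !inE => /andP[zA /forallP ze].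
rewrite unfold_in /= inE zA /=; apply/andP; split; last first.
  by have := ze i; rewrite leqnn.
apply/forallP => j; apply/implyP => kj.
have := ze j; rewrite (ltnW kj) /= => /eqP ->.
have ji : j != i by apply/eqP => e; move: kj; rewrite e ltnn.
by rewrite -(upd_neq y ord0 ji) ey upd_neq.
Qed.

(* Short fibres are deleted one at a time: deleting a fibre in direction [i] removes a point of
   [proj i A] for good, so the hypothesis leaves some points undeleted. *)
Lemma leq_card_small_proj r A :
  r * (\sum_i #|proj i A|) < #|A| -> r.+1 ^ D <= #|A|.
Proof.
have [m] := ubnP #|A|; elim: m A => // m IH A Am small.
have [/existsP [x /existsP [i /andP[xA xi]]]|] :=
    boolP [exists x, [exists i, (x \in A) && (#|fiber i x A| <= r)]]; last first.
  move=> thick; apply: leq_card_thick_fibers.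
    by apply/eqP => A0; move: small; rewrite A0 cards0.
  move=> i x xA; rewrite ltnNge; apply: contra thick => xi.
  by apply/existsP; exists x; apply/existsP; exists i; rewrite xA.
have sub : fiber i x A \subset A by apply/fintype.subsetP => y; rewrite inE => /andP[].
have pos : 0 < #|fiber i x A|.
  by rewrite card_gt0; apply/set0Pn; exists x; rewrite inE xA eqxx.
have e := cardsID (fiber i x A) A; rewrite (setIidPr sub) in e.
suff le : \sum_j #|proj j (A :\: fiber i x A)| < \sum_j #|proj j A|.
  by apply: (@leq_trans #|A :\: fiber i x A|); [apply: IH; nia | lia].
rewrite (bigD1 i) //= [ltnRHS](bigD1 i) //= -addSn; apply: leq_add; last first.
  apply: leq_sum => j _; apply: subset_leq_card; apply: imsetS.
  by rewrite subDset subsetUr.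
apply: proper_card; apply/properP; split; first by apply: imsetS; rewrite subDset subsetUr.
exists (upd x i ord0); first by apply/imsetP; exists x.
apply/imsetP => -[y]; rewrite inE => /andP[+ yA] ey.
by rewrite inE yA ey eqxx.
Qed.

(** Discrete intermediate value theorem: membership in [A] changes along the line, hence between two
    consecutive positions. *)
Lemma line_boundaryP i A x t : x \in A -> upd x i t \notin A ->
  exists2 yz, yz \in line_boundary i A & upd yz.1 i ord0 = upd x i ord0.
Proof.
move=> xA tA; pose P s := upd x i (inord s) \in A.
have [/existsP [u Pu]|/existsPn const] := boolP [exists u : 'I_n, P u != P u.+1].
  have un := ltn_ord u; set y := upd x i (inord u); set z := upd x i (inord u.+1).
  have y_i : y i = u :> nat by rewrite upd_at inordK // ltnS ltnW.
  have z_i : z i = u.+1 :> nat by rewrite upd_at inordK.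
  case Ay: (y \in A); move: Pu; rewrite /P -/y -/z Ay.
    rewrite eq_sym eqb_id => Az; exists (y, z); last by rewrite upd_upd.
    by rewrite inE /= Ay Az y_i z_i eqxx andbT /y upd_upd upd_at /=; apply/eqP.
  rewrite eq_sym eqbF_neg negbK => Az; exists (z, y); last by rewrite upd_upd.
  by rewrite inE /= Ay Az y_i z_i eqxx orbT andbT /z upd_upd upd_at /=; apply/eqP.
have P0 s : s <= n -> P s = P 0.
  elim: s => // s IH sn; rewrite -(IH (ltnW sn)).
  by apply/esym/eqP; have := const (Ordinal sn); rewrite negbK.
have := P0 t (leq_ord t); rewrite -(P0 (x i) (leq_ord _)) /P !inord_val upd_id.
by rewrite xA (negbTE tA).
Qed.

Lemma leq_card_line_boundary i A : #|line_boundary i A| <= #|boundary A|.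
Proof. by apply/subset_leq_card/fintype.subsetP => x xi; rewrite inE; apply/existsP; exists i. Qed.

(** A line meeting [A] either lies in [A], contributing [n.+1] points, or carries a boundary
    edge. *)
Lemma leq_card_proj i A : #|proj i A| * n.+1 <= #|boundary A| * n.+1 + #|A|.
Proof.
pose F := [set y in proj i A | [forall t, upd y i t \in A]].
have leF : #|F| * n.+1 <= #|A|.
  rewrite -[X in _ * X](card_ord n.+1) -cardsT -cardsX.
  rewrite -(card_in_imset (f := fun yt : V * 'I_n.+1 => upd yt.1 i yt.2)).
    apply/subset_leq_card/fintype.subsetP => _ /imsetP [[y t] + ->].
    by rewrite !inE andbT /= => /andP[_ /forallP].
  move=> [y s] [z t]; rewrite !inE !andbT /=.
  move=> /andP[/imsetP [y' _ ->] _] /andP[/imsetP [z' _ ->] _]; rewrite !upd_upd => e.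
  have st : s = t by rewrite -(upd_at y' i s) e upd_at.
  by move: e; rewrite st => /eq_upd ->.
suff le : #|proj i A| <= #|F| + #|boundary A| by nia.
apply: leq_trans (leq_add (leqnn _) (leq_card_line_boundary i A)).
apply: leq_trans (leq_add (leqnn _) (leq_imset_card (fun yz => upd yz.1 i ord0) _)).
apply: leq_trans (leq_card_setU _ _); apply/subset_leq_card/fintype.subsetP => y yA.
rewrite inE [y \in F]inE yA /=; case: forallP => //= /forallP /forallPn [t yt].
move: yA yt => /imsetP [x xA ->]; rewrite upd_upd => xt.
by have [yz yzA <-] := line_boundaryP xA xt; apply: imset_f.
Qed.

(** With [r] the integer part of the [D]-th root of [#|A|], [leq_card_small_proj] bounds [#|A|] by
    [r] times the sum of the projections. As [2 * D * r <= n.+1], full lines account for at most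
    half of [#|A|]. *)
Lemma isoperimetry_small q A : 0 < #|A| -> (2 * D) ^ D * #|A| <= n.+1 ^ D ->
  q ^ D <= #|A| -> 0 < D -> maxn q 1 ^ D.-1 <= 2 * D * #|boundary A|.
Proof.
move=> A0 Asmall qA D0.
have ex : exists r, r ^ D <= #|A| by exists q.
have bd r : r ^ D <= #|A| -> r <= #|A|.
  apply: leq_trans; case: r => // r; rewrite -[leqLHS]expn1; exact: leq_pexp2l.
case: (ex_maxnP ex bd) => r rA rmax.
have r1 : 0 < r by apply: rmax; rewrite exp1n.
have qr : q <= r by apply: rmax.
have rn : 2 * D * r <= n.+1.
  by rewrite -(leq_exp2r _ _ D0) expnMn; apply: leq_trans Asmall; rewrite leq_mul2l rA orbT.
have big : #|A| <= r * \sum_i #|proj i A|.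
  rewrite leqNgt; apply/negP => /leq_card_small_proj /rmax; lia.
have proj_le : (\sum_i #|proj i A|) * n.+1 <= D * (#|boundary A| * n.+1 + #|A|).
  rewrite big_distrl /= -[X in X * _]card_ord -sum_nat_const.
  by apply: leq_sum => i _; apply: leq_card_proj.
have e1 : #|A| <= 2 * D * r * #|boundary A|.
  by move: big proj_le rn; move: (\sum_i _) #|A| #|boundary A| => s c e; nia.
have e2 : r ^ D.-1 * r <= 2 * D * #|boundary A| * r.
  by rewrite -expnSr prednK //; apply: leq_trans rA _; lia.
rewrite leq_mul2r in e2; apply: leq_trans (_ : r ^ D.-1 <= _); last by case/orP: e2 => //; lia.
by case: (D.-1) => // k; rewrite leq_exp2r // geq_max qr.
Qed.

(* The pairs (x, y) and (mix k x y, mix k y x) determine each other, and mix k x y moves from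
   x to y one coordinate at a time. *)
Definition mix (k : nat) x y : V := [ffun j : 'I_D => if j < k then y j else x j].

Lemma mixK k x y : mix k (mix k x y) (mix k y x) = x.
Proof. by apply/ffunP => j; rewrite !ffunE; case: (j < k). Qed.

Lemma card_line_boundary_points i A :
  #|[set x in A | [exists t, upd x i t \notin A]]| <= #|boundary A| * n.+1.
Proof.
rewrite -(card_in_imset (f := fun x => (upd x i ord0, x i))); last first.
  by move=> x y _ _ [e e']; rewrite -(upd_id x i) -(upd_id y i) e' (eq_upd _ e).
rewrite -[X in _ <= _ * X](card_ord n.+1) -[X in _ <= _ * X]cardsT.
apply: leq_trans (leq_mul (leq_card_line_boundary i A) (leqnn _)).
apply: leq_trans (leq_mul (leq_imset_card (fun yz => upd yz.1 i ord0) _) (leqnn _)).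
rewrite -cardsX; apply/subset_leq_card/fintype.subsetP => _ /imsetP [x + ->].
rewrite inE => /andP[xA /existsP [t tA]]; rewrite !inE andbT /=.
by have [yz yzA <-] := line_boundaryP xA tA; apply: imset_f.
Qed.

(** On the way from [x] in [A] to [y] outside, some step [i] leaves [A]. The map to
    [(mix i x y, mix i y x)] is injective, so the pairs leaving at step [i] number at most the
    points of [A] whose line in direction [i] leaves [A], times the size of the box. *)
Lemma cheeger A : #|A| * #|~: A| <= D * #|boundary A| * n.+1 * n.+1 ^ D.
Proof.
pose F (i : 'I_D) := [set xy | (mix i xy.1 xy.2 \in A) && (mix i.+1 xy.1 xy.2 \notin A)].
have leF i : #|F i| <= #|boundary A| * n.+1 * n.+1 ^ D.
  rewrite -(card_in_imset (f := fun xy => (mix i xy.1 xy.2, mix i xy.2 xy.1))); last first.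
    move=> [x y] [x' y'] _ _ /= [e e'].
    by congr pair; [rewrite -(mixK i x y) | rewrite -(mixK i y x)]; rewrite e e' mixK.
  apply: leq_trans (leq_mul (card_line_boundary_points i A) (leqnn _)).
  rewrite -card_box -cardsT -cardsX; apply/subset_leq_card/fintype.subsetP => _ /imsetP [[x y] + ->].
  rewrite !inE andbT /= => /andP[-> xyA]; apply/existsP; exists (y i).
  apply: contra xyA; congr (_ \in A); apply/ffunP => j; rewrite !ffunE ltnS.
  by rewrite (leq_eqVlt j) -val_eqE; case: eqP => //= /val_inj ->.
rewrite -cardsX.
apply: (@leq_trans (\sum_(i in 'I_D) #|F i|)); last first.
  apply: (@leq_trans (\sum_(i in 'I_D) (#|boundary A| * n.+1 * n.+1 ^ D))).
    by apply: leq_sum => i _.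
  by rewrite sum_nat_const card_ord !mulnA.
apply: (@leq_trans #|\bigcup_(i in 'I_D) F i|); last first.
  apply: (big_ind2 (fun (X : {set V * V}) c => #|X| <= c)) => [|X c Y c' Xc Yc|//].
    by rewrite cards0.
  by apply: leq_trans (leq_card_setU _ _) (leq_add Xc Yc).
apply/subset_leq_card/fintype.subsetP => -[x y].
rewrite !inE /= => /andP[xA yA].
have [/existsP [i iA]|/existsPn const] :=
    boolP [exists i : 'I_D, (mix i x y \in A) && (mix i.+1 x y \notin A)].
  by apply/bigcupP; exists i => //; rewrite inE.
have mixA k : k <= D -> mix k x y \in A.
  elim: k => [_|k IH kD].
    by rewrite (_ : mix 0 x y = x) //; apply/ffunP => j; rewrite ffunE.
  by have := const (Ordinal kD); rewrite /= (IH (ltnW kD)) /= negbK.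
suff e : mix D x y = y by have := mixA D (leqnn _); rewrite e (negbTE yA).
by apply/ffunP => j; rewrite ffunE ltn_ord.
Qed.

Lemma card_boundaryC A : #|boundary (~: A)| = #|boundary A|.
Proof.
suff le (B : {set V}) : #|boundary (~: B)| <= #|boundary B|.
  by apply/eqP; rewrite eqn_leq le -{1}(setCK A) le.
rewrite -(card_in_imset (f := fun xy => (xy.2, xy.1))); last by move=> [x y] [x' y'] _ _ [-> ->].
apply/subset_leq_card/fintype.subsetP => _ /imsetP [[x y] + ->]; rewrite !inE.
case/existsP => i; rewrite !inE negbK /= => /and4P[xB yB /eqP e xy].
apply/existsP; exists i; rewrite inE /= xB yB orbC xy andbT.
by rewrite e upd_upd upd_id eqxx.
Qed.

End Box.

(** Crude discrete derivative of the [D]-th power; the factor 3 absorbs the three terms produced by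
    each induction step. *)
Lemma leq_expS_maxn D q : q.+1 ^ D <= q ^ D + 3 ^ D * maxn q 1 ^ D.-1.
Proof.
case: D => // D; rewrite -pred_Sn; case: q => [|q].
  by rewrite max0n !exp1n muln1 exp0n // add0n expn_gt0.
rewrite (maxn_idPl _) //; elim: D => [|D IH]; first by rewrite !expn1 expn0; lia.
have W : q.+1 ^ D <= 3 ^ D.+1 * q.+1 ^ D by rewrite leq_pmull // expn_gt0.
rewrite (expnS q.+2) (expnS q.+1 D.+1) (expnS 3 D.+1) -mulnA.
move: IH W; rewrite !(expnS q.+1 D) [3 ^ _ * (_ * _)]mulnCA.
move: (q.+1 ^ D) (3 ^ D.+1 * _) (q.+2 ^ D.+1) => P W Z; nia.
Qed.

(** * Families of slices *)

Lemma leq_telescope (M e : nat -> nat) H k l :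
  (forall i, i <= H -> M i.+1 + e i <= M i) -> k <= l <= H.+1 ->
  M l + \sum_(k <= i < l) e i <= M k.
Proof.
move=> dec /andP[kl]; elim: l kl => [|l IH].
  by rewrite leqn0 => /eqP -> _; rewrite big_geq // addn0.
rewrite leq_eqVlt => /orP[/eqP <- _|]; first by rewrite big_geq // addn0.
rewrite ltnS => kl lH; have := IH kl (ltnW lH); have := dec l lH.
by rewrite big_nat_recr //=; lia.
Qed.

Section Slices.
(** In the application [M k] counts the cut edges whose inner endpoint has height at least [k], and
    [B] bounds [b / a]. Abstracting them lets the same estimates serve for the complements of the
    slices read from the top. *)
Variables (D n B H : nat) (A : nat -> {set {ffun 'I_D -> 'I_n.+1}}) (M : nat -> nat).
Hypotheses (D0 : 0 < D) (B0 : 0 < B).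
Hypothesis M_dec : forall k, k <= H -> M k.+1 + #|boundary (A k)| <= M k.
Hypothesis M_up : forall k, k <= H -> M k.+1 <= B * #|A k|.
Hypothesis M_low : forall k, k <= H -> #|A k| <= M k.

Lemma M_anti k l : k <= l <= H.+1 -> M l <= M k.
Proof. by move=> kl; apply: leq_trans (leq_telescope M_dec kl); apply: leq_addr. Qed.

Lemma slice_card_le i j : i <= j <= H -> #|A j| <= B * #|A i|.
Proof.
move=> /andP[]; rewrite leq_eqVlt => /orP[/eqP <- _|ij jH]; first by rewrite leq_pmull.
apply: leq_trans (M_low jH) (leq_trans (M_anti _) (M_up _)); lia.
Qed.

(* Discrete form of: F' <= - c F^(1 - 1/D) forces F^(1/D) to decrease linearly to 0. *)
Lemma slices_vanish m : m <= H -> B * (2 * D) ^ D * #|A m| <= n.+1 ^ D ->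
  forall j, m + 2 * D * B * 3 ^ D * n.+2 <= j <= H -> A j = set0.
Proof.
move=> mH small; set C := 2 * D * B * 3 ^ D.
(* Here [q] exceeds the [D]-th root of [M k.+1 / B]; every [C] levels lower it by one, and at
   [q = 0] the bound is contradictory. *)
suff vanish q k j : m <= k -> k + C * q <= j <= H -> M k.+1 < B * q ^ D -> A j = set0.
  (* The bound on [M] is strict, so the start is [n.+2] and not [n.+1]. *)
  move=> j jH; apply: (vanish n.+2 m j) => //.
  apply: leq_ltn_trans (M_up mH) _; rewrite ltn_pmul2l //.
  apply: (@leq_ltn_trans (n.+1 ^ D)); last by rewrite ltn_exp2r.
  apply: leq_trans small; rewrite leq_pmull //.
  by rewrite muln_gt0 B0 expn_gt0 muln_gt0 D0.
elim: q k => [|q IH] k mk; first by rewrite exp0n // !muln0.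
rewrite mulnS addnA => /andP[kj jH] small_k.
(* If [M] is still at least [B * q ^ D] after [C] levels, all slices on the way have at least
   [q ^ D] points, and their boundaries add up to too much for the bound on [M k.+1]. *)
have [le|gt] := ltnP (M (k + C).+1) (B * q ^ D).
  by apply: (IH (k + C)); rewrite ?kj //; lia.
apply/eqP; rewrite -cards_eq0; apply: contraTT small_k; rewrite -lt0n -leqNgt => Aj.
have kCj : k + C <= j by apply: leq_trans kj; apply: leq_addr.
(* Nonemptiness passes down from [A j] to [A i], smallness passes up from [A m], both by
   [slice_card_le]. *)
have bd i : k.+1 <= i < (k + C).+1 -> maxn q 1 ^ D.-1 <= 2 * D * #|boundary (A i)|.
  move=> /andP[ki iC]; have ij : i <= j <= H by rewrite jH andbT; lia.
  have iH : i <= H by lia.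
  apply: isoperimetry_small => //.
  - by have := slice_card_le ij; case: #|A i| => //; rewrite muln0; lia.
  - have mi : m <= i <= H by lia.
    by apply: leq_trans small; rewrite mulnAC mulnC leq_mul2r mulnC slice_card_le ?orbT.
  rewrite -(leq_pmul2l B0); apply: leq_trans gt _; apply: leq_trans (M_up iH).
  by apply: M_anti; lia.
have range : k.+1 <= (k + C).+1 <= H.+1 by lia.
have := leq_telescope M_dec range.
have: C * maxn q 1 ^ D.-1 <= 2 * D * \sum_(k.+1 <= i < (k + C).+1) #|boundary (A i)|.
  rewrite big_distrr /= -{1}[C](_ : (k + C).+1 - k.+1 = C) -?sum_nat_const_nat; last lia.
  by rewrite [leqLHS]big_nat_cond [leqRHS]big_nat_cond; apply: leq_sum => i; rewrite andbT => /bd.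
have := leq_expS_maxn D q; rewrite -(leq_pmul2l (m := 2 * D * B)) ?muln_gt0 ?D0 //.
rewrite mulnDr mulnA -/C.
move: gt; move: (\sum_(_ <= i < _) _) => s gt e1 e2 e3.
rewrite -(leq_pmul2l (m := 2 * D)) ?muln_gt0 ?D0 // mulnA.
apply: leq_trans e1 _; apply: leq_trans (leq_add (leqnn _) e2) _.
by rewrite -mulnA -mulnDr leq_mul2l; apply/orP; right; lia.
Qed.

End Slices.

(** A slice is small when it fills at most [1 / K] of the box. The second term counts the levels
    where neither slice nor complement is small, the third the two ends, each of
    [C * n.+2 <= 3 * C * n] levels; the 1 absorbs an off-by-one. *)
Definition cut_height D B :=
  let K := B * (2 * D) ^ D in 1 + 2 * (K ^ 2 * D * B) + 6 * (2 * D * B * 3 ^ D).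

(** Let [m1] be the last level with a small complement and [m2] the first with a small slice. Slices
    are empty far above [m2] and full far below [m1]; Cheeger's inequality bounds the distance
    between the two. *)
Lemma slices_extent D n B H (A : nat -> {set {ffun 'I_D -> 'I_n.+1}}) (M M' : nat -> nat) :
  0 < D -> 0 < B -> 0 < n ->
  (forall k, k <= H -> M k.+1 + #|boundary (A k)| <= M k) ->
  (forall k, k <= H -> M k.+1 <= B * #|A k|) ->
  (forall k, k <= H -> #|A k| <= M k) ->
  (forall k, k <= H -> M' k.+1 + #|boundary (A (H - k))| <= M' k) ->
  (forall k, k <= H -> M' k.+1 <= B * #|~: A (H - k)|) ->
  (forall k, k <= H -> #|~: A (H - k)| <= M' k) ->
  M 0 <= B * n.+1 ^ D -> A 0 = setT -> A H = set0 ->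
  forall i j, i <= H -> j <= H -> A i != setT -> A j != set0 ->
  j <= i + cut_height D B * n.
Proof.
move=> D0 B0 n0 M1 M2 M3 M1' M2' M3' total A0 AH i j iH jH Ai Aj.
rewrite /cut_height; set K := B * _; set C := 2 * D * B * 3 ^ D.
pose N := n.+1 ^ D.
have ex2 : exists k, K * #|A k| <= N by exists H; rewrite AH cards0 muln0.
case: (ex_minnP ex2) => m2 small2 min2.
have ex1 : exists k, (k <= H) && (K * #|~: A k| <= N).
  by exists 0; rewrite A0 setCT cards0 muln0.
have bd1 k : (k <= H) && (K * #|~: A k| <= N) -> k <= H by case/andP.
case: (ex_maxnP ex1 bd1) => m1 /andP[m1H small1] max1.
have m2H : m2 <= H by apply: min2; rewrite AH cards0 muln0.
have jm2 : j < m2 + C * n.+2.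
  rewrite ltnNge; apply: contra Aj => jm2.
  by apply/eqP; apply: (slices_vanish D0 B0 M1 M2 M3 m2H small2); rewrite jm2.
(* The complements, read from the top, form a family of the same kind with [M'] in place of [M]. *)
have im1 : H - i < H - m1 + C * n.+2.
  rewrite ltnNge; apply: contra Ai => im1.
  have M1c k : k <= H -> M' k.+1 + #|boundary (~: A (H - k))| <= M' k.
    by rewrite card_boundaryC; apply: M1'.
  have HmH : H - m1 <= H by apply: leq_subr.
  have := @slices_vanish D n B H (fun k => ~: A (H - k)) M' D0 B0 M1c M2' M3' _ HmH.
  rewrite subKn // => /(_ small1 (H - i)); rewrite im1 leq_subr subKn // => /(_ isT) e.
  by rewrite -[A i]setCK e setC0.
(* Each boundary strictly between [m1] and [m2] has at least [N / (K ^ 2 * D * n.+1)] edges, and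
   together they have at most [M 0 <= B * N]. *)
have mid : m2 - m1.+1 <= K ^ 2 * D * n.+1 * B.
  have [le|lt] := leqP m2 m1.+1; first by rewrite (eqP (_ : m2 - m1.+1 == 0)) // subn_eq0.
  have N0 : 0 < N by rewrite expn_gt0.
  have range : 0 <= m1.+1 <= H.+1 by lia.
  rewrite -(leq_pmul2r N0) -sum_nat_const_nat.
  apply: (@leq_trans (K ^ 2 * D * n.+1 * M 0)); last first.
    by rewrite -(mulnA _ B) leq_mul2l total orbT.
  have range2 : m1.+1 <= m2 <= H.+1 by lia.
  apply: (@leq_trans (K ^ 2 * D * n.+1 * \sum_(m1.+1 <= k < m2) #|boundary (A k)|)); last first.
    rewrite leq_mul2l; apply/orP; right.
    have := leq_telescope M1 range2; have := leq_telescope M1 range; lia.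
  rewrite big_distrr /= [leqLHS]big_nat_cond [leqRHS]big_nat_cond; apply: leq_sum => k.
  rewrite andbT => /andP[m1k km2].
  have g1 : N < K * #|A k| by rewrite ltnNge; apply/negP => /min2; lia.
  have g2 : N < K * #|~: A k|.
    rewrite ltnNge; apply/negP => le; have := max1 k; rewrite le andbT => h.
    by have := h (ltnW (leq_trans km2 m2H)); lia.
  have ch := cheeger (A k); rewrite -/N in ch.
  rewrite -(leq_pmul2r N0).
  apply: (@leq_trans (K ^ 2 * (D * #|boundary (A k)| * n.+1 * N))).
    by apply: leq_trans (_ : K ^ 2 * (#|A k| * #|~: A k|) <= _); [nia | rewrite leq_mul2l ch orbT].
  by rewrite !mulnA [X in _ <= X * _]mulnAC.
have mid' : m2 - m1.+1 <= 2 * (K ^ 2 * D * B) * n.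
  by apply: leq_trans mid _; rewrite mulnAC; move: (K ^ 2 * D * B) => X; nia.
have ends : C * n.+2 <= 3 * C * n by nia.
rewrite !mulnDl mul1n; move: mid'; move: (2 * _ * n) => X mid'; nia.
Qed.

(** * Minimal separating sets in the cylinder graph *)

Local Open Scope ring_scope.

Notation vertex D n H := ({ffun 'I_D -> 'I_n.+1} * 'I_H.+1)%type.

Definition site (D n H : nat) (p : vertex D n H) : 'rV[int]_D.+1 :=
  \row_i oapp (fun j => (p.1 j)%:Z) (p.2)%:Z (unlift ord_max i).

Definition adjacent (D n H : nat) (p q : vertex D n H) := neighbor (site p) (site q).

Definition crossing (D n H : nat) (S : {set vertex D n H}) :=
  [set pq | [&& pq.1 \in S, pq.2 \notin S & adjacent pq.1 pq.2]].

(** For [k > H] the default of [inord] gives the bottom slice, so statements on slices assume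
    [k <= H]. *)
Definition slice (D n H : nat) (S : {set vertex D n H}) (k : nat) :=
  [set v | (v, inord k) \in S].

Definition crossing_above (D n H : nat) (S : {set vertex D n H}) (k : nat) :=
  #|[set pq in crossing S | (k <= pq.1.2)%N]|.

Definition separating (D n H : nat) (S : {set vertex D n H}) : Prop :=
  forall p : vertex D n H, (p.2 = 0%N :> nat -> p \in S) /\ (p.2 = H :> nat -> p \notin S).

Definition min_separating (R : realType) (D n H : nat)
    (c : vertex D n H * vertex D n H -> R) (S : {set vertex D n H}) : Prop :=
  separating S /\ forall S', separating S' ->
    \sum_(pq in crossing S) c pq <= \sum_(pq in crossing S') c pq.

Section Graph.
Variables D n H : nat.
Local Notation P := (vertex D n H).
Implicit Types (v x y : {ffun 'I_D -> 'I_n.+1}) (p q : P) (S : {set P}).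

Lemma site_lift p j : site p 0 (lift ord_max j) = p.1 j.
Proof. by rewrite mxE liftK. Qed.

Lemma site_max p : site p 0 ord_max = p.2.
Proof. by rewrite mxE unlift_none. Qed.

Lemma site_inj : injective (@site D n H).
Proof.
move=> [v k] [w l] e; congr pair.
  apply/ffunP => j; have := congr1 (fun x : 'rV_D.+1 => x 0 (lift ord_max j)) e.
  by rewrite /= !site_lift => -[] /val_inj.
have := congr1 (fun x : 'rV_D.+1 => x 0 ord_max) e.
by rewrite /= !site_max => -[] /val_inj.
Qed.

Lemma adjacentE p q : adjacent p q =
  (\sum_j `|(p.1 j)%:Z - (q.1 j)%:Z| + `|(p.2)%:Z - (q.2)%:Z| == 1).
Proof.
rewrite /adjacent /neighbor (bigD1_ord ord_max) //= !site_max addrC.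
by congr (_ + _ == _); apply: eq_bigr => j _; rewrite !site_lift.
Qed.

Lemma adjacent_sym p q : adjacent p q = adjacent q p.
Proof.
rewrite !adjacentE; congr (_ + _ == _); last by rewrite distrC.
by apply: eq_bigr => j _; rewrite distrC.
Qed.

Lemma adjacent_horizontal (A : {set {ffun 'I_D -> 'I_n.+1}}) x y (k : 'I_H.+1) :
  (x, y) \in boundary A -> adjacent ((x, k) : P) (y, k).
Proof.
rewrite inE => /existsP [i]; rewrite inE /= => /and4P[_ _ /eqP e xy].
rewrite adjacentE /= subrr normr0 addr0 (bigD1 i) //= big1 ?addr0.
  by apply/eqP; case/orP: xy => /eqP ->; lia.
by move=> j ji; rewrite e upd_neq // subrr.
Qed.

Lemma adjacent_vertical v (k l : 'I_H.+1) : l = k.+1 :> nat -> adjacent ((v, k) : P) (v, l).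
Proof.
move=> e; rewrite adjacentE /= big1 ?add0r; last by move=> j _; rewrite subrr.
by rewrite e; apply/eqP; lia.
Qed.

Lemma adjacent_height p q : adjacent p q -> (p.2 <= q.2.+1)%N.
Proof.
rewrite adjacentE => /eqP e.
have: 0 <= \sum_j `|(p.1 j)%:Z - (q.1 j)%:Z| by apply: sumr_ge0.
move: e; move: (\sum_j _) (nat_of_ord p.2) (nat_of_ord q.2) => s k l; lia.
Qed.

Lemma adjacent_slice p q : adjacent p q -> p.2 != q.2 -> p.1 = q.1.
Proof.
rewrite adjacentE -val_eqE /= => /eqP; set s := \sum_j _ => e pq.
have s0 : 0 <= s by apply: sumr_ge0.
have {s0 e}: s = 0 by lia.
move/psumr_eq0P => h; apply/ffunP => j; apply/val_inj.
by have /eqP := h (fun _ _ => normr_ge0 _) j isT; rewrite normr_eq0 subr_eq0 => /eqP [].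
Qed.

(** The complement is taken as well, so that after the reflection the set again contains the bottom
    and misses the top. *)
Definition flip S : {set P} := [set p | (p.1, rev_ord p.2) \notin S].

Definition flip_edge (pq : P * P) : P * P :=
  ((pq.2.1, rev_ord pq.2.2), (pq.1.1, rev_ord pq.1.2)).

Lemma flipK : involutive flip.
Proof. by move=> S; apply/setP => -[v k]; rewrite !inE /= rev_ordK negbK. Qed.

Lemma flip_edgeK : involutive flip_edge.
Proof. by move=> [[v k] [w l]]; rewrite /flip_edge /= !rev_ordK. Qed.

Lemma adjacent_flip p q :
  adjacent (q.1, rev_ord q.2) (p.1, rev_ord p.2) = adjacent p q.
Proof.
rewrite adjacent_sym !adjacentE /=; congr (_ + _ == _).
have := ltn_ord p.2; have := ltn_ord q.2; lia.
Qed.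

Lemma crossing_flip S pq : (pq \in crossing (flip S)) = (flip_edge pq \in crossing S).
Proof. by rewrite !inE /= adjacent_flip negbK andbCA. Qed.

Lemma separating_flip S : separating S -> separating (flip S).
Proof.
move=> sep p; have [s0 sH] := sep (p.1, rev_ord p.2); rewrite inE negbK.
by split=> e; [apply: sH | apply: s0] => /=; rewrite e; lia.
Qed.

Lemma slice_flip S k : (k <= H)%N -> slice (flip S) k = ~: slice S (H - k).
Proof.
move=> kH; apply/setP => v; rewrite !inE /=; congr (~~ (_ \in S)); congr pair.
by apply/val_inj; rewrite /= !inordK // ltnS ?leq_subr // subSS.
Qed.

Lemma min_separating_flip (R : realType) (c : P * P -> R) S :
  min_separating c S -> min_separating (c \o flip_edge) (flip S).
Proof.
have sumE T : \sum_(pq in crossing (flip T)) (c \o flip_edge) pq = \sum_(pq in crossing T) c pq.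
  rewrite [RHS](reindex_inj (inv_inj flip_edgeK)); apply: eq_bigl => pq.
  by rewrite -crossing_flip.
move=> [sep mins]; split; first exact: separating_flip.
move=> S' /separating_flip /mins; rewrite sumE => /le_trans; apply.
by rewrite -{2}(flipK S') sumE.
Qed.

(** * Exchange arguments for a minimal separating set *)

Section Crossing.
Variables (R : realType) (a b : R) (c : P * P -> R) (B : nat) (S : {set P}).
Hypotheses (a0 : 0 < a) (bB : b <= a * B%:R).
Hypothesis c_bd : forall pq, adjacent pq.1 pq.2 -> a <= c pq <= b.
Hypothesis minS : min_separating c S.

(** Minimality forces the removed edges [X] to cost at most the added edges [Y]; each removed edge
    costs at least [a], each added one at most [b <= a * B]. *)
Lemma crossing_exchange S' (X Y : {set P * P}) : separating S' ->
  X \subset crossing S -> crossing S' \subset (crossing S :\: X) :|: Y ->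
  (forall pq, pq \in Y -> adjacent pq.1 pq.2) -> (#|X| <= B * #|Y|)%N.
Proof.
move=> sep XS S'Y adjY.
have cr_adj (T : {set P}) pq : pq \in crossing T -> adjacent pq.1 pq.2 by rewrite inE => /and3P[].
have sumXY : \sum_(pq in X) c pq <= \sum_(pq in Y) c pq.
  have := minS.2 _ sep.
  rewrite (big_setID X) /= (setIidPr XS) addrC.
  have: \sum_(pq in crossing S') c pq <=
      \sum_(pq in crossing S :\: X) c pq + \sum_(pq in Y) c pq.
    apply: (@le_trans _ _ (\sum_(pq in (crossing S :\: X) :|: Y) c pq)).
      rewrite [leRHS](big_setID (crossing S')) /= (setIidPr S'Y) lerDl.
      apply: sumr_ge0 => pq; rewrite !inE => /andP[_ /orP[/andP[_ /and3P[_ _ /c_bd]]|/adjY /c_bd]].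
        by move=> /andP[+ _]; apply: le_trans; apply: ltW.
      by move=> /andP[+ _]; apply: le_trans; apply: ltW.
    rewrite big_mkcond [X in _ <= X + _]big_mkcond [X in _ <= _ + X]big_mkcond -big_split /=.
    apply: ler_sum => pq _; rewrite in_setU.
    case: (boolP (pq \in crossing S :\: X)) => [pqS|_];
      case: (boolP (pq \in Y)) => [/adjY /c_bd /andP[le _]|_] //=;
      by rewrite ?addr0 ?add0r // lerDl (le_trans (ltW a0)).
  by move=> up low; have := le_trans low up; rewrite lerD2l.
have lowX : a * #|X|%:R <= \sum_(pq in X) c pq.
  rewrite mulr_natr -sumr_const; apply: ler_sum => pq /(subsetP XS) /cr_adj /c_bd.
  by case/andP.
have upY : \sum_(pq in Y) c pq <= b * #|Y|%:R.
  by rewrite mulr_natr -sumr_const; apply: ler_sum => pq /adjY /c_bd /andP[].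
rewrite -(ler_nat R) natrM -(ler_pM2l a0) mulrA.
apply: le_trans (le_trans lowX (le_trans sumXY upY)) _.
by apply: ler_wpM2r.
Qed.

(** Horizontal boundary edges of the slice start exactly at height [k], hence drop out of the count
    at [k.+1]. *)
Lemma crossing_above_dec k : (k <= H)%N ->
  (crossing_above S k.+1 + #|boundary (slice S k)| <= crossing_above S k)%N.
Proof.
move=> kH; have kK : inord k = k :> nat := @inordK H k kH.
pose f (xy : {ffun 'I_D -> 'I_n.+1} * {ffun 'I_D -> 'I_n.+1}) : P * P :=
  ((xy.1, inord k), (xy.2, inord k)).
have f_inj : injective f by move=> [x y] [x' y'] [-> ->].
rewrite -(card_imset _ f_inj) /crossing_above -leq_subRL; last first.
  by apply/subset_leq_card/subsetP => pq; rewrite !inE => /andP[-> /ltnW].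
rewrite -cardsDS; last first.
  by apply/subsetP => pq; rewrite !inE => /andP[-> /ltnW].
apply/subset_leq_card/subsetP => _ /imsetP [[x y] xyS ->].
rewrite !inE /= kK ltnn leqnn andbF /= (adjacent_horizontal _ xyS) !andbT.
by move: xyS; rewrite inE => /existsP [i]; rewrite !inE => /and4P[-> ->].
Qed.

Lemma crossing_above_up k : (k <= H)%N -> (crossing_above S k.+1 <= B * #|slice S k|)%N.
Proof.
rewrite leq_eqVlt => /orP[/eqP ->|kH].
  rewrite /crossing_above (_ : [set _ in _ | _] = set0) ?cards0 //.
  by apply/setP => pq; rewrite !inE leqNgt ltn_ord andbF.
have kK : inord k = k :> nat := @inordK H k (ltnW kH).
have k1K : inord k.+1 = k.+1 :> nat := @inordK H k.+1 kH.
pose f (v : {ffun 'I_D -> 'I_n.+1}) : P * P := ((v, inord k), (v, inord k.+1)).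
apply: leq_trans (leq_mul (leqnn B) (leq_imset_card f _)).
(* The competitor is [S] truncated at height [k]: its new crossing edges lead to points of [S] above
   [k], so they are vertical and start in the slice. *)
apply: (@crossing_exchange [set p in S | (p.2 <= k)%N]).
- move=> p; rewrite !inE; have [s0 sH] := minS.1 p; split=> e; first by rewrite s0 ?e.
  by rewrite (negbTE (sH e)).
- by apply/subsetP => pq; rewrite inE => /andP[].
- apply/subsetP => -[p q]; rewrite !inE /= => /and3P[/andP[pS pk] qk pq].
  rewrite pS pq (ltnNge k) pk andbF !andbT /=.
  have [qS|//] := boolP (q \in S); rewrite qS /= -ltnNge in qk; apply/imsetP.
  have e : p.1 = q.1 by apply: (adjacent_slice pq); rewrite -val_eqE /=; lia.
  have := adjacent_height (etrans (adjacent_sym _ _) pq) => h.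
  exists p.1; last first.
    case: p q e pS pk pq qk qS h => [v l] [w m] /= <- *; rewrite /f; congr ((_, _), (_, _)).
      by apply/val_inj; rewrite /= kK; lia.
    by apply/val_inj; rewrite /= k1K; lia.
  rewrite inE (_ : inord k = p.2) -?surjective_pairing //.
  by apply/val_inj; rewrite /= kK; lia.
- by move=> _ /imsetP [v _ ->]; apply: adjacent_vertical; rewrite kK k1K.
Qed.

(** Every column of the slice must leave [S] before the top, through a vertical edge at height at
    least [k]. *)
Lemma slice_le_crossing_above k : (k <= H)%N -> (#|slice S k| <= crossing_above S k)%N.
Proof.
move=> kH; apply: leq_trans (leq_imset_card (fun pq => pq.1.1) _).
apply/subset_leq_card/subsetP => v; rewrite inE => vS.
have [/existsP [l /and3P[kl lS lS']]|/existsPn const] := boolP [exists l : 'I_H,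
    [&& (k <= l)%N, (v, inord l) \in S & (v, inord l.+1) \notin S]].
  have lK : (inord l : 'I_H.+1) = l :> nat by apply: inordK; rewrite ltnS ltnW.
  have l1K : (inord l.+1 : 'I_H.+1) = l.+1 :> nat by apply: inordK; rewrite ltnS.
  apply/imsetP; exists ((v, inord l), (v, inord l.+1)) => //.
  by rewrite !inE /= lS lS' lK kl andbT; apply: adjacent_vertical; rewrite lK l1K.
have allS l : (k <= l <= H)%N -> (v, inord l) \in S.
  elim: l => [|l IH]; first by rewrite andbT leqn0 => /eqP <-.
  move=> /andP[]; rewrite leq_eqVlt => /orP[/eqP <- //|]; rewrite ltnS => kl lH.
  have lS : (v, inord l) \in S by apply: IH; rewrite kl ltnW.
  by apply: contraNT (const (Ordinal lH)) => nS; rewrite /= kl lS.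
have [_ top] := minS.1 (v, inord H).
by have := top (inordK (ltnSn H)); rewrite allS // kH leqnn.
Qed.

(** The competitor is the bottom layer, with one vertical crossing edge per column; [0 < H] keeps it
    away from the top. *)
Lemma crossing_total : (0 < H)%N -> (crossing_above S 0 <= B * n.+1 ^ D)%N.
Proof.
move=> H0; pose o1 : 'I_H.+1 := inord 1.
have o1K : o1 = 1%N :> nat by apply: inordK.
pose f (v : {ffun 'I_D -> 'I_n.+1}) : P * P := ((v, ord0), (v, o1)).
rewrite -card_box -cardsT; apply: leq_trans (leq_mul (leqnn B) (leq_imset_card f _)).
apply: (@crossing_exchange [set p | p.2 == ord0]).
- move=> p; rewrite !inE -val_eqE /=; split=> e; rewrite e //.
  by rewrite -lt0n.
- by apply/subsetP => pq; rewrite inE => /andP[].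
- apply/subsetP => -[p q]; rewrite !inE /= => /and3P[p0 q0 pq].
  apply/orP; right; apply/imsetP; exists p.1 => //.
  have e : p.1 = q.1 by apply: (adjacent_slice pq); rewrite (eqP p0) eq_sym.
  have := adjacent_height (etrans (adjacent_sym _ _) pq) => h.
  case: p q e p0 q0 pq h => [v l] [w m] /= <- /eqP -> m0 _ m1; rewrite /f; congr (_, (_, _)).
  by apply/val_inj; rewrite /= o1K; move: m0 m1; rewrite -val_eqE /=; lia.
- by move=> _ /imsetP [v _ ->]; apply: adjacent_vertical; rewrite o1K.
Qed.

End Crossing.

(** The inner endpoint of [pq] shows that its slice is nonempty, the outer endpoint of [rs] that its
    slice is not full. *)
Lemma crossing_extent (R : realType) (a b : R) (c : P * P -> R) (B : nat) S pq rs :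
  (0 < D)%N -> (0 < B)%N -> (0 < n)%N -> (0 < H)%N -> 0 < a -> b <= a * B%:R ->
  (forall pq, adjacent pq.1 pq.2 -> a <= c pq <= b) -> min_separating c S ->
  pq \in crossing S -> rs \in crossing S ->
  (pq.1.2 <= rs.2.2 + cut_height D B * n)%N.
Proof.
move=> D0 B0 n0 H0 a0 bB c_bd minS; rewrite !inE => /and3P[pS _ _] /and3P[_ sS _].
have minS' := min_separating_flip minS.
have c_bd' pq' : adjacent pq'.1 pq'.2 -> a <= (c \o flip_edge) pq' <= b.
  by move=> h; apply: c_bd; rewrite /= adjacent_flip.
have flipped k : (k <= H)%N -> ~: slice S (H - k) = slice (flip S) k.
  by move=> kH; rewrite slice_flip.
apply: (@slices_extent D n B H (slice S) (crossing_above S) (crossing_above (flip S))) => //.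
- by move=> k; apply: crossing_above_dec.
- by move=> k; apply: (crossing_above_up a0 bB c_bd minS).
- by move=> k; apply: (slice_le_crossing_above minS).
- by move=> k kH; rewrite -card_boundaryC flipped //; apply: crossing_above_dec.
- by move=> k kH; rewrite flipped //; apply: (crossing_above_up a0 bB c_bd' minS').
- by move=> k kH; rewrite flipped //; apply: (slice_le_crossing_above minS').
- exact: (crossing_total a0 bB c_bd minS).
- by apply/setP => v; rewrite !inE; apply: (minS.1 _).1; rewrite /= inordK.
- by apply/setP => v; rewrite !inE; apply/negbTE; apply: (minS.1 _).2; rewrite /= inordK.
- by rewrite -ltnS.
- by rewrite -ltnS.
- apply: contra sS => /eqP e; have: rs.2.1 \in slice S rs.2.2 by rewrite e inE.
  by rewrite inE inord_val -surjective_pairing.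
- apply/set0Pn; exists pq.1.1.
  by rewrite inE inord_val -surjective_pairing.
Qed.

End Graph.

(** * Cutsets *)

Section Edges.
Variables D n H : nat.
Local Notation P := (vertex D n H).
Implicit Types (p q : P) (S : {set P}) (E : {fset edge D.+1}).

Definition edge_of (pq : P * P) : edge D.+1 := [fset site pq.1; site pq.2]%fset.

Definition cut S : {fset edge D.+1} := [fset edge_of pq | pq in crossing S]%fset.

Definition avoids E p q := adjacent p q && (edge_of (p, q) \notin E).

Definition reachable E : {set P} :=
  [set p : P | [exists p0 : P, (p0.2 == ord0) && connect (avoids E) p0 p]].

Lemma cutP S e : reflect (exists2 pq, pq \in crossing S & e = edge_of pq) (e \in cut S).
Proof.
apply: (iffP (imfsetP _ _ _ _)) => -[pq pqS ->]; exists pq => //.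
Qed.

(** Exactly one endpoint of a crossing edge lies in [S], so the unordered edge determines its
    orientation. *)
Lemma edge_of_inj S : {in crossing S &, injective edge_of}.
Proof.
move=> [p q] [p' q']; rewrite !inE /= => /and3P[pS qS _] /and3P[p'S q'S _] e.
have: site p \in edge_of (p', q') by rewrite -e !inE eqxx.
have: site q \in edge_of (p', q') by rewrite -e !inE eqxx orbT.
rewrite !inE !(inj_eq (@site_inj D n H)) /=.
case/orP => /eqP eq; first by rewrite eq p'S in qS.
case/orP => /eqP ep; last by rewrite ep (negbTE q'S) in pS.
by rewrite ep eq.
Qed.

Lemma capacity_cut (R : realType) (t : edge D.+1 -> R) S :
  capacity t (cut S) = \sum_(pq in crossing S) t (edge_of pq).
Proof.
rewrite /capacity big_imfset /=; last exact: edge_of_inj.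
by rewrite big_enum.
Qed.

Lemma crossing_reachable E pq : pq \in crossing (reachable E) -> edge_of pq \in E.
Proof.
case: pq => p q; rewrite !inE /= => /and3P[/existsP [p0 /andP[p00 p0p]] + pq].
apply: contraR => pqE; apply/existsP; exists p0; rewrite p00 /=.
by apply: connect_trans p0p (connect1 _); rewrite /avoids pq pqE.
Qed.

End Edges.

From mathcomp Require Import boolp classical_sets.
Local Open Scope classical_set_scope.

(** * Passage between the real cylinder and its finite vertex set *)

Section Cylinder.
Variables (R : realType) (D n H : nat).
Local Notation P := (vertex D n H).
Implicit Types (p q : P) (E : {fset edge D.+1}) (u v : R).

Lemma cylinder_site u v p :
  cylinder D.+1 n u v (embed R (site p)) <-> u <= (p.2)%:R <= v.
Proof.
split=> [/(_ ord_max)|h i]; first by rewrite ltnn !mxE unlift_none.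
rewrite !mxE; case: unliftP => [j|] ->; last by rewrite ltnn.
by rewrite lift_max !ltnS ltn_ord /= ler0n ler_nat -ltnS ltn_ord.
Qed.

Lemma int_range (z : int) (m : nat) :
  0 <= (z%:~R : R) <= m%:R -> exists k : 'I_m.+1, z = k%:Z.
Proof.
rewrite ler0z -[m%:R]/(m%:Z%:~R) ler_int; case: z => // k /= km.
by have lt : (k < m.+1)%N by []; exists (Ordinal lt).
Qed.

Lemma cylinder_siteP (x : 'rV[int]_D.+1) :
  cylinder D.+1 n 0 H%:R (embed R x) -> exists p : P, x = site p.
Proof.
move=> xC; have [k kx] : exists k : 'I_H.+1, x 0 ord_max = k%:Z.
  by apply: int_range; have := xC ord_max; rewrite ltnn mxE.
have vx j : exists k : 'I_n.+1, x 0 (lift ord_max j) = k%:Z.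
  by apply: int_range; have := xC (lift ord_max j); rewrite lift_max ltnS ltn_ord mxE.
have [v vP] := choice vx.
exists ([ffun j => v j], k); apply/rowP => i; rewrite mxE.
by case: unliftP => [j|] -> //=; rewrite ffunE vP.
Qed.

Lemma convex_range (u v s c d : R) : 0 <= s <= 1 -> u <= c <= v -> u <= d <= v ->
  u <= (1 - s) * c + s * d <= v.
Proof.
move=> /andP[s0 s1] /andP[uc cv] /andP[ud dv]; have s1' : 0 <= 1 - s by rewrite subr_ge0.
have e w : w = (1 - s) * w + s * w by rewrite -mulrDl subrK mul1r.
by apply/andP; split; [rewrite (e u)|rewrite (e v)]; rewrite lerD // ler_wpM2l.
Qed.

Lemma segment_sub_cylinder (x y : 'rV[int]_D.+1) u v :
  segment R [fset x; y]%fset `<=` cylinder D.+1 n u v <->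
  cylinder D.+1 n u v (embed R x) /\ cylinder D.+1 n u v (embed R y).
Proof.
split=> [sub|[xC yC] z [x' [y' [e [s [s01 ->]]]]] i].
  split; apply: sub; exists x, y; split=> //.
    by exists 0; rewrite lexx ler01 subr0 scale1r scale0r addr0.
  by exists 1; rewrite lexx ler01 subrr scale0r scale1r add0r.
(* The endpoints given by [segment] may come in either order, so both are located through membership
   in the edge. *)
have inC w : w \in [fset x; y]%fset -> cylinder D.+1 n u v (embed R w) by case/fset2P => ->.
have /inC x'C : x' \in [fset x; y]%fset by rewrite e !inE eqxx.
have /inC y'C : y' \in [fset x; y]%fset by rewrite e !inE eqxx orbT.
have := x'C i; have := y'C i; rewrite !mxE.
by case: ifP => _ ? ?; apply: convex_range.
Qed.

Lemma segment_edge_of p q u v :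
  segment R (edge_of (p, q)) `<=` cylinder D.+1 n u v <->
  u <= (p.2)%:R <= v /\ u <= (q.2)%:R <= v.
Proof. by rewrite segment_sub_cylinder !cylinder_site. Qed.

Lemma segment_edge_of_cylinder p q : segment R (edge_of (p, q)) `<=` cylinder D.+1 n 0 H%:R.
Proof. by apply/segment_edge_of; rewrite !ler0n !ler_nat !leq_ord. Qed.

Lemma cylinder_edge_of p q : adjacent p q -> cylinder_edge R n H (edge_of (p, q)).
Proof.
move=> pq; split; first by exists (site p), (site q).
exact: segment_edge_of_cylinder.
Qed.

Lemma cutset_cut (S : {set P}) : separating S -> cutset R n H (cut S).
Proof.
move=> sep; split.
  move=> e /cutP [[p q] + ->]; rewrite inE => /and3P[_ _]; exact: cylinder_edge_of.
(* Induction along the path, from any start in [S]: a path that ends outside [S] has a step leaving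
   [S]. *)
have cross l r : r \in S -> path (@neighbor D.+1) (site r) l ->
    (forall e, e \in path_edges (site r) l -> segment R e `<=` cylinder D.+1 n 0 H%:R) ->
    (forall s : P, last (site r) l = site s -> s \notin S) ->
    exists e, e \in path_edges (site r) l /\ e \in cut S.
  elim: l r => [|y l IH] r rS /=; first by move=> _ _ /(_ r erefl); rewrite rS.
  move=> /andP[ry yl] inC out.
  have /segment_sub_cylinder [_ /cylinder_siteP [s ys]] := inC _ (mem_head _ _).
  subst y; have [sS|sS] := boolP (s \in S).
    have [|e [el eS]] := IH s sS yl _ out; last by exists e; rewrite inE el orbT.
    by move=> e el; apply: inC; rewrite inE el orbT.
  exists (edge_of (r, s)); split; first exact: mem_head.
  by apply/cutP; exists (r, s) => //; rewrite inE /= rS sS.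
move=> x l xB lT xl inC.
have [r xr] : exists r : P, x = site r.
  apply: cylinder_siteP => i; have := xB i; case: ifP => // _ /andP[-> /le_trans]; apply.
  by rewrite ler0n.
subst x; have r0 : r.2 = 0%N :> nat.
  by have /cylinder_site := xB; rewrite lern0 => /andP[_ /eqP].
apply: (cross l r) => //; first exact: (sep r).1.
move=> s ls; apply: (sep s).2; move: lT; rewrite ls => /cylinder_site.
by rewrite !ler_nat => h; apply/eqP; rewrite eqn_leq andbC.
Qed.

(** A reachable top vertex would give a path from bottom to top that avoids [E]. *)
Lemma reachable_separating E : cutset R n H E -> separating (reachable n H E).
Proof.
move=> [_ cutE] p; rewrite inE; split=> [p0|pH].
  by apply/existsP; exists p; rewrite connect0 andbT; apply/eqP/val_inj.
apply/negP => /existsP [p0 /andP[/eqP p00 /connectP [l pl lp]]].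
have {pl} [nl el] : path (@neighbor D.+1) (site p0) (map (@site D n H) l) /\
    forall e, e \in path_edges (site p0) (map (@site D n H) l) ->
      e \notin E /\ segment R e `<=` cylinder D.+1 n 0 H%:R.
  elim: l p0 pl {p00 lp} => [|q l IH] r //= /andP[/andP[rq rqE] /IH [nl el]].
  split; first by apply/andP.
  move=> e; rewrite inE => /orP[/eqP ->|/el //]; split => //.
  exact: segment_edge_of_cylinder.
have := cutE (site p0) (map (@site D n H) l).
rewrite last_map -lp => -[||//|e /el [_ //]|e [/el [eE _]]]; last by rewrite (negbTE eE).
- by apply/cylinder_site; rewrite p00 lexx.
- by apply/cylinder_site; rewrite pH lexx.
Qed.

(** The cut around the reachable set is a cutset contained in [E]; capacities being positive, an
    extra edge in [E] would contradict minimality. *)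
Lemma minimal_cutset_reachable (t : edge D.+1 -> R) E :
  (forall e, cylinder_edge R n H e -> 0 < t e) -> minimal_cutset n H t E ->
  min_separating (t \o @edge_of D n H) (reachable n H E) /\ E = cut (reachable n H E).
Proof.
move=> t0 [Ecut Emin]; set S : {set P} := reachable n H E.
have sep : separating S := reachable_separating Ecut.
have sub : (cut S `<=` E)%fset.
  by apply/fsubsetP => _ /cutP [pq pqS ->]; apply: crossing_reachable.
suff EE : E = cut S.
  split=> //; split=> // S' sep'; rewrite -!capacity_cut -EE.
  by apply: Emin; apply: cutset_cut.
apply/eqP; rewrite eqEfsubset sub andbT; apply/fsubsetP => e eE; apply/negPn/negP => eS.
(* Extending the capacity of the cut by zero allows a termwise comparison of two sums over [E]. *)
pose t' e := if e \in cut S then t e else 0.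
have capS : capacity t (cut S) = \sum_(f <- E) t' f.
  rewrite -(big_fset_incl _ sub) => [|f _ fS]; last by rewrite /t' (negbTE fS).
  by apply: eq_big_seq => f fS; rewrite /t' fS.
have := Emin _ (cutset_cut sep); rewrite capS /capacity.
rewrite (big_fsetD1 e) //= [leRHS](big_fsetD1 e) //= {1}/t' (negbTE eS) add0r leNgt.
apply/negP/negPn; apply: ltr_pwDl; first exact: t0 (Ecut.1 _ eE).
rewrite big_seq [leRHS]big_seq; apply: ler_sum => f; rewrite !inE => /andP[_ fE].
by rewrite /t'; case: ifP => // _; apply: ltW; apply: t0 (Ecut.1 _ fE).
Qed.

End Cylinder.

Theorem proposition2p1 (R : realType) (d : nat) (a b : R)
    (hd : (2 <= d)%N) (ha : 0 < a) (hab : a < b) :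
  exists h0 : nat, (0 < h0)%N /\ ~~ odd h0 /\
    forall (n H : nat) (t : edge d -> R),
      (1 <= n)%N ->
      2^-1 * h0%:R * n%:R <= H%:R :> R ->
      (forall e : edge d, cylinder_edge R n H e -> t e = a \/ t e = b) ->
      forall E : {fset edge d}, minimal_cutset n H t E ->
        exists u : R, 0 <= u /\
          forall e : edge d, e \in E ->
            segment R e `<=` cylinder d n u (u + 2^-1 * h0%:R * n%:R).
Proof.
case: d hd => // D hD; pose B := Num.bound (b / a).
have b0 : 0 < b := lt_trans ha hab.
have bB : b <= a * B%:R.
  by rewrite mulrC -ler_pdivrMr //; apply/ltW/archi_boundP; rewrite divr_ge0 // ltW.
have B0 : (0 < B)%N.
  by rewrite -(ltr_nat R) -(pmulr_rgt0 _ ha); apply: lt_le_trans bB.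
(* Taking [h0 = 2 * h] makes half of it an integer; the extra 2 covers one unit at each end of the
   height range. *)
pose h := (cut_height D B + 2)%N.
exists (2 * h)%N; split; first by rewrite muln_gt0 /h addn2.
split; first by rewrite mul2n odd_double.
move=> n H t n0; rewrite natrM mulrA mulVf ?pnatr_eq0 // mul1r -natrM ler_nat => hH tab E Emin.
have t0 e : cylinder_edge R n H e -> 0 < t e by move=> /tab [] ->.
have [minS ->] := minimal_cutset_reachable t0 Emin.
set S := reachable n H E in minS *.
have H0 : (0 < H)%N by apply: leq_trans hH; rewrite muln_gt0 n0 andbT /h addn2.
have c_bd pq : adjacent pq.1 pq.2 -> a <= (t \o @edge_of D n H) pq <= b.
  by case: pq => p q /(cylinder_edge_of R) /tab [] /= ->; rewrite lexx ltW.
have [S0|/finset.set0Pn [rs0 rs0S]] := eqVneq (crossing S) finset.set0.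
  by exists 0; split=> // e /cutP [pq]; rewrite S0 inE.
case: (arg_minnP (fun rs : vertex D n H * vertex D n H => nat_of_ord rs.2.2) rs0S) => rs rsS rs_min.
(* [rs] has the lowest outer endpoint, and inner endpoints lie at most one level below their outer
   ones. *)
exists (rs.2.2).-1%:R; split; first exact: ler0n.
move=> _ /cutP [[p q] pqS ->]; apply/segment_edge_of; rewrite -natrD !ler_nat.
have := crossing_extent hD B0 n0 H0 ha bB c_bd minS pqS rsS.
have := rs_min _ pqS; move: (pqS); rewrite inE => /and3P[_ _ pq] /=.
have := adjacent_height pq; have := adjacent_height (etrans (adjacent_sym _ _) pq) => /=.
have : (cut_height D B * n + 2 <= h * n)%N by rewrite /h mulnDl leq_add2l leq_pmulr.
move: (h * n)%N (cut_height D B * n)%N (nat_of_ord p.2) (nat_of_ord q.2) (nat_of_ord rs.2.2).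
lia.
Qed.
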